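(* Let $\mathfrak{c}=(A,c,\Delta_c,\varepsilon_c)$ and $\mathfrak{d}=(B,d,\Delta_d,\varepsilon_d)$ be comonads in a 2-category $\mathcal{B}$, let $(p,q):\mathfrak{d}\to\mathfrak{c}$ be a comonad-morphism with adjunction, and let $\Omega$ be a 0-cell of $\mathcal{B}$. Suppose that $\mathrm{Rcom}(\Omega,\mathfrak{d})$ satisfies the equalizer condition for $p$. Then the pullback functor $\mathscr{P}:\mathrm{Rcom}(\Omega,\mathfrak{c})\to\mathrm{Rcom}(\Omega,\mathfrak{d})$ associated to $p$ is fully faithful if and only if $\underline{\mathrm{can}}:p\bullet d\bullet q\to c$ is an isomorphism and the pushout functor $\mathscr{Q}:\mathrm{Rcom}(\Omega,\mathfrak{d})\to\mathrm{Rcom}(\Omega,\mathfrak{c})$ preserves the equalizers of the form $$n\bullet^c(p\bullet d)\xrightarrow{\ \mathrm{eq}_n\ } n\bullet p\bullet d\rightrightarrows n\bullet c\bullet p\bullet d\qquad (n\in\mathrm{Rcom}(\Omega,\mathfrak{c})).$$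
   Context: $\mathcal{B}$ is a (strict) 2-category. $\mathrm{Hom}(A,B)$ is the category of 1-cells $A\to B$ and 2-cells between them; vertical composition is $\circ$. The composite of $f:A\to B$ and $g:B\to C$ is written $f\bullet g:A\to C$ (diagrammatic order), and $\bullet$ also denotes horizontal composition of 2-cells; the identity 2-cell of $f$ is written $f$ and the identity 1-cell of $A$ is written $A$. A comonad $\mathfrak{c}=(A,c,\Delta_c,\varepsilon_c)$: a 1-cell $c:A\to A$ with 2-cells $\Delta_c:c\to c\bullet c$, $\varepsilon_c:c\to A$, coassociative and counital. For a 0-cell $\Omega$, $\mathrm{Rcom}(\Omega,\mathfrak{c})$ has objects $(m,\rho^m)$ with $m:\Omega\to A$ a 1-cell and $\rho^m:m\to m\bullet c$ satisfying $(\rho^m\bullet c)\circ\rho^m=(m\bullet\Delta_c)\circ\rho^m$, $(m\bullet\varepsilon_c)\circ\rho^m=m$; morphisms are 2-cells $\psi:m\to n$ with $\rho^n\circ\psi=(\psi\bullet c)\circ\rho^m$. A comonad-morphism with adjunction $(p,q):\mathfrak{d}\to\mathfrak{c}$ consists of 1-cells $p:A\to B$, $q:B\to A$ and 2-cells $\mu:p\bullet q\to A$, $\eta:B\to q\bullet p$ with $(q\bullet\mu)\circ(\eta\bullet q)=q$ and $(\mu\bullet p)\circ(p\bullet\eta)=p$, together with a 2-cell $\alpha:d\bullet q\to q\bullet c$ such that $(q\bullet\Delta_c)\circ\alpha=(\alpha\bullet c)\circ(d\bullet\alpha)\circ(\Delta_d\bullet q)$ and $(q\bullet\varepsilon_c)\circ\alpha=\varepsilon_d\bullet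 q$. Put $\underline{\mathrm{can}}=(\mu\bullet c)\circ(p\bullet\alpha):p\bullet d\bullet q\to c$, $\beta=(\underline{\mathrm{can}}\bullet p)\circ(p\bullet d\bullet\eta):p\bullet d\to c\bullet p$ and $\lambda^{p\bullet d}=(\beta\bullet d)\circ(p\bullet\Delta_d):p\bullet d\to c\bullet p\bullet d$. Pushout functor: $\mathscr{Q}(x,\rho)=(x\bullet q,(x\bullet\alpha)\circ(\rho\bullet q))$, $\mathscr{Q}(\phi)=\phi\bullet q$. Equalizer condition for $p$: for every $(n,\rho)\in\mathrm{Rcom}(\Omega,\mathfrak{c})$, the pair $\rho\bullet p\bullet d,\ n\bullet\lambda^{p\bullet d}:n\bullet p\bullet d\rightrightarrows n\bullet c\bullet p\bullet d$ (with right $\mathfrak{d}$-coactions $n\bullet p\bullet\Delta_d$ and $n\bullet c\bullet p\bullet\Delta_d$) has an equalizer in $\mathrm{Rcom}(\Omega,\mathfrak{d})$, denoted $\mathrm{eq}_n:n\bullet^c(p\bullet d)\to n\bullet p\bullet d$. The pullback functor is then $\mathscr{P}(n)=n\bullet^c(p\bullet d)$ (with its action on morphisms induced by the universal property); it is right adjoint to $\mathscr{Q}$.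
   Formalization: Added assumption on Ω: if x•can is an isomorphism for every 1-cell x:Ω→A, then can is an isomorphism (automatic for Ω=A); without it the ''only if'' direction fails, e.g. for Ω the empty category. *)

(* Defs.v *)
From Corelib Require Import ssreflect.
From Stdlib Require Import ProofIrrelevance IndefiniteDescription.

Set Implicit Arguments.
Unset Strict Implicit.
Unset Printing Implicit Defensive.

Declare Scope cell_scope.
Delimit Scope cell_scope with cell.
Local Open Scope cell_scope.

Reserved Notation "g \; f" (at level 50, left associativity).
Reserved Notation "f ~= g" (at level 70, no associativity).
Reserved Notation "f ** g" (at level 40, left associativity).
Reserved Notation "f *> g" (at level 41, no associativity).
Reserved Notation "f <* g" (at level 41, no associativity).

Record category : Type := Category {
  obj :> Type;
  mor : obj -> obj -> Type;
  idm : forall x, mor x x;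
  comp : forall x y z, mor y z -> mor x y -> mor x z;
  comp_idl : forall x y (f : mor x y), comp (idm y) f = f;
  comp_idr : forall x y (f : mor x y), comp f (idm x) = f;
  compA : forall x y z t (h : mor z t) (g : mor y z) (f : mor x y),
    comp h (comp g f) = comp (comp h g) f
}.
Arguments mor {_} _ _.
Arguments idm {_} _.
Arguments comp {_ _ _ _} _ _.

(* Applicative order: [g \; f] is "g after f". *)
Notation "g \; f" := (comp g f) : cell_scope.

(* The identity of [x], seen as a morphism along an equality of objects. *)
Definition eqm {C : category} {x y : C} (e : x = y) : mor x y :=
  match e in _ = z return mor x z with eq_refl => idm x end.

(* Equality of morphisms whose sources and targets are equal, but not
   necessarily by conversion.  On parallel morphisms it is Leibniz equality
   (lemma [same_eq]). *)
Inductive same {C : category} {x y : C} (f : mor x y) :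
    forall x' y' : C, mor x' y' -> Prop :=
  same_refl : same f f.
Notation "f ~= g" := (same f g) : cell_scope.

Definition is_iso {C : category} {x y : C} (f : mor x y) : Prop :=
  exists g : mor y x, g \; f = idm x /\ f \; g = idm y.

Record functor (C D : category) : Type := Functor {
  fob :> C -> D;
  fmap : forall x y, mor x y -> mor (fob x) (fob y);
  fmap_id : forall x, fmap (idm x) = idm (fob x);
  fmap_comp : forall x y z (g : mor y z) (f : mor x y),
    fmap (g \; f) = fmap g \; fmap f
}.
Arguments fmap {_ _} _ {_ _} _.

Definition full {C D : category} (F : functor C D) : Prop :=
  forall (x y : C) (g : mor (F x) (F y)), exists f : mor x y, fmap F f = g.

Definition faithful {C D : category} (F : functor C D) : Prop :=
  forall (x y : C) (f g : mor x y), fmap F f = fmap F g -> f = g.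

Definition fully_faithful {C D : category} (F : functor C D) : Prop :=
  full F /\ faithful F.

Definition is_equalizer {C : category} {e x y : C} (i : mor e x)
    (f g : mor x y) : Prop :=
  f \; i = g \; i /\
  forall (z : C) (h : mor z x), f \; h = g \; h ->
    exists! k : mor z e, i \; k = h.

Record equalizer {C : category} {x y : C} (f g : mor x y) : Type := Equalizer {
  eq_ob : C;
  eq_arr : mor eq_ob x;
  eq_arrP : is_equalizer eq_arr f g
}.

Definition preserves_equalizer {C D : category} (F : functor C D) {x y : C}
    (f g : mor x y) (E : equalizer f g) : Prop :=
  is_equalizer (fmap F (eq_arr E)) (fmap F f) (fmap F g).

(* [hcompA], [hcomp_1l] and [hcomp_1r] complete the equalities [comp1A],
   [comp1_1l] and [comp1_1r] of 1-cells: horizontal composition is strictly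
   associative and unital. *)
Record two_category : Type := TwoCategory {
  cell0 :> Type;
  hom : cell0 -> cell0 -> category;
  one : forall A, hom A A;
  comp1 : forall A B C, hom A B -> hom B C -> hom A C;
  hcomp : forall A B C (f f' : hom A B) (g g' : hom B C),
    mor f f' -> mor g g' -> mor (comp1 f g) (comp1 f' g');
  hcomp_id : forall A B C (f : hom A B) (g : hom B C),
    hcomp (idm f) (idm g) = idm (comp1 f g);
  interchange : forall A B C (f f' f'' : hom A B) (g g' g'' : hom B C)
      (s : mor f f') (s' : mor f' f'') (t : mor g g') (t' : mor g' g''),
    hcomp (s' \; s) (t' \; t) = hcomp s' t' \; hcomp s t;
  comp1A : forall A B C D (f : hom A B) (g : hom B C) (h : hom C D),
    comp1 f (comp1 g h) = comp1 (comp1 f g) h;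
  comp1_1l : forall A B (f : hom A B), comp1 (one A) f = f;
  comp1_1r : forall A B (f : hom A B), comp1 f (one B) = f;
  hcompA : forall A B C D (f f' : hom A B) (g g' : hom B C) (h h' : hom C D)
      (s : mor f f') (t : mor g g') (u : mor h h'),
    hcomp s (hcomp t u) ~= hcomp (hcomp s t) u;
  hcomp_1l : forall A B (f f' : hom A B) (s : mor f f'),
    hcomp (idm (one A)) s ~= s;
  hcomp_1r : forall A B (f f' : hom A B) (s : mor f f'),
    hcomp s (idm (one B)) ~= s
}.
Arguments hom {_} _ _.
Arguments one {_} _.
Arguments comp1 {_ _ _ _} _ _.
Arguments hcomp {_ _ _ _ _ _ _ _} _ _.

(* Diagrammatic order: first [f : A -> B], then [g : B -> C]. *)
Notation "f ** g" := (comp1 f g) : cell_scope.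
(* Horizontal composition with the identity 2-cell of a 1-cell. *)
Notation "f *> t" := (hcomp (idm f) t) : cell_scope.
Notation "s <* g" := (hcomp s (idm g)) : cell_scope.

(* Identity 2-cells between equal 1-cells, needed only to make vertical
   composites typecheck. *)
Section Coherence.
Context {B : two_category} {X Y Z T : B}.
Definition asc (f : hom X Y) (g : hom Y Z) (h : hom Z T) :
  mor (f ** (g ** h)) (f ** g ** h) := eqm (comp1A f g h).
Definition csa (f : hom X Y) (g : hom Y Z) (h : hom Z T) :
  mor (f ** g ** h) (f ** (g ** h)) := eqm (eq_sym (comp1A f g h)).
Definition lun (f : hom X Y) : mor (one X ** f) f := eqm (comp1_1l f).
Definition nur (f : hom X Y) : mor f (f ** one Y) := eqm (eq_sym (comp1_1r f)).
End Coherence.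

Record comonad (B : two_category) : Type := Comonad {
  c0 : B;
  c1 :> hom c0 c0;
  comult : mor c1 (c1 ** c1);
  counit : mor c1 (one c0);
  coassoc : (comult <* c1) \; comult ~= (c1 *> comult) \; comult;
  counitl : (counit <* c1) \; comult ~= idm c1;
  counitr : (c1 *> counit) \; comult ~= idm c1
}.
Arguments comult {_} _.
Arguments counit {_} _.

Record comodule {B : two_category} (Om : B) (c : comonad B) : Type := Comodule {
  carrier :> hom Om (c0 c);
  coact : mor carrier (carrier ** c);
  coact_coassoc : (coact <* c) \; coact ~= (carrier *> comult c) \; coact;
  coact_counit : (carrier *> counit c) \; coact ~= idm carrier
}.
Arguments coact {_ _ _} _.

Definition colinear {B : two_category} {Om : B} {c : comonad B}
    (m n : comodule Om c) (s : mor (carrier m) (carrier n)) : Prop :=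
  coact n \; s = (s <* c) \; coact m.

Record comonad_morphism {B : two_category} (d c : comonad B) : Type :=
    ComonadMorphism {
  cm_p : hom (c0 c) (c0 d);
  cm_q : hom (c0 d) (c0 c);
  cm_mu : mor (cm_p ** cm_q) (one (c0 c));
  cm_eta : mor (one (c0 d)) (cm_q ** cm_p);
  cm_triangle_q : (cm_q *> cm_mu) \; csa _ _ _ \; (cm_eta <* cm_q) ~= idm cm_q;
  cm_triangle_p : (cm_mu <* cm_p) \; asc _ _ _ \; (cm_p *> cm_eta) ~= idm cm_p;
  cm_alpha : mor (d ** cm_q) (cm_q ** c);
  cm_alpha_comult :
    (cm_q *> comult c) \; cm_alpha
    ~= (cm_alpha <* c) \; asc _ _ _ \; (d *> cm_alpha) \; csa _ _ _
         \; (comult d <* cm_q);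
  cm_alpha_counit : (cm_q *> counit c) \; cm_alpha ~= counit d <* cm_q
}.

Section CategoryTheory.
Context {C : category}.

Lemma same_pack {x y x' y' : C} (f : mor x y) (g : mor x' y') : f ~= g ->
  existT (fun p : C * C => mor (fst p) (snd p)) (x, y) f =
  existT (fun p : C * C => mor (fst p) (snd p)) (x', y') g.
Proof. by case. Qed.

Lemma same_eq {x y : C} (f g : mor x y) : f ~= g -> f = g.
Proof. by move=> fg; apply: inj_pairT2 (same_pack fg). Qed.

Lemma eq_same {x y : C} (f g : mor x y) : f = g -> f ~= g.
Proof. by move=> ->. Qed.

Lemma same_sym {x y x' y' : C} (f : mor x y) (g : mor x' y') :
  f ~= g -> g ~= f.
Proof. by case. Qed.

Lemma same_trans {x y x' y' x'' y'' : C} (f : mor x y) (g : mor x' y')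
  (h : mor x'' y'') : f ~= g -> g ~= h -> f ~= h.
Proof. by move=> fg; case. Qed.

Lemma same_eqml {x y z : C} (e : y = z) (f : mor x y) : eqm e \; f ~= f.
Proof. by case: _ / e; rewrite /= comp_idl. Qed.

Lemma same_eqmr {x y z : C} (e : x = y) (f : mor y z) : f \; eqm e ~= f.
Proof. by case: _ / e f => f; rewrite /= comp_idr. Qed.

Lemma same_eqm {x y : C} (e : x = y) : eqm e ~= idm x.
Proof. by case: _ / e. Qed.

Lemma same_nat {x y x' y' : C} (f : mor x y) (g : mor x' y')
  (e1 : x = x') (e2 : y = y') : f ~= g -> eqm e2 \; f = g \; eqm e1.
Proof.
move=> fg; apply: same_eq; apply: same_trans (same_eqml _ _) _.
by apply: same_trans fg (same_sym (same_eqmr _ _)).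
Qed.

Lemma eqm_comp {x y z : C} (e : x = y) (e' : y = z) :
  eqm e' \; eqm e = eqm (eq_trans e e').
Proof. by case: _ / e'; rewrite /= comp_idl. Qed.

Lemma eqm_compA {x y z t : C} (e : x = y) (e' : y = z) (f : mor t x) :
  eqm e' \; (eqm e \; f) = eqm (eq_trans e e') \; f.
Proof. by rewrite compA eqm_comp. Qed.

Lemma eqm_irr {x y : C} (e e' : x = y) : eqm e = eqm e'.
Proof. by rewrite (proof_irrelevance _ e e'). Qed.

Lemma eqm_id {x : C} (e : x = x) : eqm e = idm x.
Proof. by rewrite (eqm_irr e eq_refl). Qed.

Definition eq_lift {x y : C} {f g : mor x y} (E : equalizer f g) {z : C}
    (h : mor z x) (fh : f \; h = g \; h) : mor z (eq_ob E) :=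
  proj1_sig (constructive_indefinite_description _ (proj2 (eq_arrP E) z h fh)).

Lemma eq_liftK {x y : C} {f g : mor x y} (E : equalizer f g) {z : C}
  (h : mor z x) (fh : f \; h = g \; h) : eq_arr E \; eq_lift E fh = h.
Proof.
by rewrite /eq_lift; case: constructive_indefinite_description => k [].
Qed.

Lemma eq_arrK {x y : C} {f g : mor x y} (E : equalizer f g) {z : C}
  (k k' : mor z (eq_ob E)) : eq_arr E \; k = eq_arr E \; k' -> k = k'.
Proof.
move=> kk'; have [fg U] := eq_arrP E.
have [l [_ Ul]] : exists! l, eq_arr E \; l = eq_arr E \; k'.
  by apply: U; rewrite !compA fg.
by rewrite -(Ul k kk') -(Ul k').
Qed.

End CategoryTheory.

Section TwoCategoryTheory.
Context {B : two_category}.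

Lemma lwhisker_comp {X Y Z : B} (f : hom X Y) (g g' g'' : hom Y Z)
  (t' : mor g' g'') (t : mor g g') : f *> (t' \; t) = (f *> t') \; (f *> t).
Proof. by rewrite -interchange comp_idl. Qed.

Lemma rwhisker_comp {X Y Z : B} (f f' f'' : hom X Y) (g : hom Y Z)
  (s' : mor f' f'') (s : mor f f') : (s' \; s) <* g = (s' <* g) \; (s <* g).
Proof. by rewrite -interchange comp_idl. Qed.

Lemma whisker_exchange {X Y Z : B} (f f' : hom X Y) (g g' : hom Y Z)
  (s : mor f f') (t : mor g g') : (f' *> t) \; (s <* g) = (s <* g') \; (f *> t).
Proof. by rewrite -!interchange !comp_idl !comp_idr. Qed.

Lemma lwhisker_eqm {X Y Z : B} (f : hom X Y) (g g' : hom Y Z) (e : g = g') :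
  f *> eqm e = eqm (f_equal (comp1 f) e).
Proof. by case: _ / e; rewrite /= hcomp_id. Qed.

Lemma rwhisker_eqm {X Y Z : B} (f f' : hom X Y) (g : hom Y Z) (e : f = f') :
  eqm e <* g = eqm (f_equal (fun h => comp1 h g) e).
Proof. by case: _ / e; rewrite /= hcomp_id. Qed.

Lemma lwhisker_same {X Y Z : B} (f : hom X Y) (g g' h h' : hom Y Z)
  (t : mor g g') (u : mor h h') : t ~= u -> f *> t ~= f *> u.
Proof. by case. Qed.

Lemma rwhisker_same {X Y Z : B} (f : hom Y Z) (g g' h h' : hom X Y)
  (t : mor g g') (u : mor h h') : t ~= u -> t <* f ~= u <* f.
Proof. by case. Qed.

Section Associativity.
Context {X Y Z T : B}.

Lemma asc_nat (f f' : hom X Y) (g g' : hom Y Z) (h h' : hom Z T)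
  (s : mor f f') (t : mor g g') (u : mor h h') :
  asc f' g' h' \; hcomp s (hcomp t u) = hcomp (hcomp s t) u \; asc f g h.
Proof. by apply: same_nat; apply: hcompA. Qed.

Lemma csa_nat (f f' : hom X Y) (g g' : hom Y Z) (h h' : hom Z T)
  (s : mor f f') (t : mor g g') (u : mor h h') :
  csa f' g' h' \; hcomp (hcomp s t) u = hcomp s (hcomp t u) \; csa f g h.
Proof. by apply: same_nat; apply: same_sym; apply: hcompA. Qed.

Lemma asc_lr (f : hom X Y) (g g' : hom Y Z) (h : hom Z T) (t : mor g g') :
  asc f g' h \; (f *> (t <* h)) = ((f *> t) <* h) \; asc f g h.
Proof. exact: asc_nat. Qed.

Lemma asc_ll (f : hom X Y) (g : hom Y Z) (h h' : hom Z T) (t : mor h h') :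
  asc f g h' \; (f *> (g *> t)) = (f ** g *> t) \; asc f g h.
Proof. by rewrite asc_nat hcomp_id. Qed.

Lemma asc_rr (f f' : hom X Y) (g : hom Y Z) (h : hom Z T) (s : mor f f') :
  asc f' g h \; (s <* (g ** h)) = ((s <* g) <* h) \; asc f g h.
Proof. by rewrite -asc_nat hcomp_id. Qed.

Lemma csa_rr (f f' : hom X Y) (g : hom Y Z) (h : hom Z T) (s : mor f f') :
  csa f' g h \; ((s <* g) <* h) = (s <* (g ** h)) \; csa f g h.
Proof. by rewrite csa_nat hcomp_id. Qed.

Lemma csa_lr (f : hom X Y) (g g' : hom Y Z) (h : hom Z T) (t : mor g g') :
  csa f g' h \; ((f *> t) <* h) = (f *> (t <* h)) \; csa f g h.
Proof. exact: csa_nat. Qed.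

Lemma csa_ll (f : hom X Y) (g : hom Y Z) (h h' : hom Z T) (t : mor h h') :
  csa f g h' \; (f ** g *> t) = (f *> (g *> t)) \; csa f g h.
Proof. by rewrite -csa_nat hcomp_id. Qed.

Lemma ascK (f : hom X Y) (g : hom Y Z) (h : hom Z T) :
  csa f g h \; asc f g h = idm _.
Proof. by rewrite /asc /csa eqm_comp eqm_id. Qed.

Lemma csaK (f : hom X Y) (g : hom Y Z) (h : hom Z T) :
  asc f g h \; csa f g h = idm _.
Proof. by rewrite /asc /csa eqm_comp eqm_id. Qed.

Lemma llE (f : hom X Y) (g : hom Y Z) (h h' : hom Z T) (t : mor h h') :
  f ** g *> t = asc f g h' \; ((f *> (g *> t)) \; csa f g h).
Proof. by rewrite compA asc_ll -compA csaK comp_idr. Qed.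

Lemma lrE (f : hom X Y) (g g' : hom Y Z) (h : hom Z T) (t : mor g g') :
  (f *> t) <* h = asc f g' h \; ((f *> (t <* h)) \; csa f g h).
Proof. by rewrite compA asc_lr -compA csaK comp_idr. Qed.

End Associativity.
End TwoCategoryTheory.

Ltac coh :=
  rewrite /asc /csa /lun /nur ?(lwhisker_eqm, rwhisker_eqm) -?compA
    ?(eqm_compA, eqm_comp);
  repeat (reflexivity || apply: eqm_irr || apply: f_equal2).

Section Rcom.
Context {B : two_category} (Om : B) (c : comonad B).

Definition comodule_mor (m n : comodule Om c) : Type :=
  {s : mor (carrier m) (carrier n) | colinear s}.

Lemma comodule_mor_eq {m n : comodule Om c} (s t : comodule_mor m n) :
  proj1_sig s = proj1_sig t -> s = t.
Proof. by apply: eq_sig_hprop => ? ? ?; apply: proof_irrelevance. Qed.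

Lemma colinear_id (m : comodule Om c) : colinear (idm (carrier m)).
Proof. by rewrite /colinear hcomp_id comp_idl comp_idr. Qed.

Lemma colinear_comp (m n o : comodule Om c) (t : comodule_mor n o)
  (s : comodule_mor m n) : colinear (proj1_sig t \; proj1_sig s).
Proof.
case: t s => [t tP] [s sP]; rewrite /colinear /=.
by rewrite compA tP -compA sP compA -rwhisker_comp.
Qed.

Definition Rcom : category.
Proof.
refine (@Category (comodule Om c) comodule_mor
  (fun m => exist _ _ (colinear_id m))
  (fun m n o t s => exist _ _ (colinear_comp t s)) _ _ _);
  move=> *; apply: comodule_mor_eq.
- exact: comp_idl.
- exact: comp_idr.
- exact: compA.
Defined.

End Rcom.

Section Cofree.
Context {B : two_category} {Om : B} (d : comonad B).

(* The coaction [x ** comult d] on [x ** d]. *)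
Definition cofree_coact (x : hom Om (c0 d)) : mor (x ** d) (x ** d ** d) :=
  asc x d d \; (x *> comult d).

Lemma cofree_coassoc (x : hom Om (c0 d)) :
  (cofree_coact x <* d) \; cofree_coact x
  ~= (x ** d *> comult d) \; cofree_coact x.
Proof.
have co : (comult d <* d) \; comult d
    = asc d d d \; ((d *> comult d) \; comult d).
  apply: same_eq; apply: same_trans (coassoc d) _.
  exact: same_sym (same_eqml _ _).
rewrite /cofree_coact rwhisker_comp -compA (compA _ (asc x d d)) -asc_lr.
rewrite -(compA _ _ (x *> _)) -lwhisker_comp co !lwhisker_comp !compA -asc_ll.
rewrite -(compA _ (x *> asc d d d)) /asc lwhisker_eqm rwhisker_eqm !compA.
rewrite !eqm_comp -!compA.
apply: same_trans (same_eqml _ _) _.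
exact: same_sym (same_eqml _ _).
Qed.

Lemma cofree_counit (x : hom Om (c0 d)) :
  (x ** d *> counit d) \; cofree_coact x ~= idm (x ** d).
Proof.
rewrite /cofree_coact compA -asc_ll -compA -lwhisker_comp.
apply: same_trans (same_eqml _ _) _.
by rewrite -hcomp_id; apply: lwhisker_same; apply: counitr.
Qed.

Definition cofree (x : hom Om (c0 d)) : Rcom Om d :=
  Comodule (cofree_coassoc x) (cofree_counit x).

Lemma cofree_colinear (x y : hom Om (c0 d)) (s : mor x y) :
  @colinear _ _ _ (cofree x) (cofree y) (s <* d).
Proof.
rewrite /colinear /= /cofree_coact -compA whisker_exchange !compA.
by rewrite asc_rr.
Qed.

End Cofree.
Arguments cofree_coact {_ _} _ _.
Arguments cofree_coassoc {_ _} _ _.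
Arguments cofree {_ _} _ _.
Arguments cofree_colinear {_ _} _ {_ _} _.

Section Pushout.
Context {B : two_category} {d c : comonad B} (M : comonad_morphism d c) (Om : B).
Local Notation q := (cm_q M).
Local Notation alpha := (cm_alpha M).

(* [(x ** alpha) o (rho ** q)] *)
Definition pushout_coact (x : comodule Om d) : mor (x ** q) (x ** q ** c) :=
  asc x q c \; (x *> alpha) \; csa x d q \; (coact x <* q).

Lemma pushout_coassoc (x : comodule Om d) :
  (pushout_coact x <* c) \; pushout_coact x
  ~= (x ** q *> comult c) \; pushout_coact x.
Proof.
have aD : (q *> comult c) \; alpha = csa _ _ _ \; ((alpha <* c) \; asc _ _ _
    \; (d *> alpha) \; csa _ _ _ \; (comult d <* q)).
  apply: same_eq; apply: same_trans (cm_alpha_comult M) _.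
  exact: same_sym (same_eqml _ _).
have rD : (coact x <* d) \; coact x
    = asc _ _ _ \; ((x *> comult d) \; coact x).
  apply: same_eq; apply: same_trans (coact_coassoc x) _.
  exact: same_sym (same_eqml _ _).
suff ->: (pushout_coact x <* c) \; pushout_coact x
    = asc _ _ _ \; ((x ** q *> comult c) \; pushout_coact x).
  exact: same_eqml.
rewrite {2}/pushout_coact !compA -(compA (asc _ _ _) (_ *> _) (asc _ _ _)).
rewrite -asc_ll -!compA (compA (x *> _) (x *> _)) -lwhisker_comp aD.
rewrite !lwhisker_comp -!compA.
rewrite (compA (x *> (comult d <* q))) -csa_lr.
rewrite /pushout_coact !rwhisker_comp -!compA.
rewrite (compA _ (asc x q c)) -asc_rr -!compA.
rewrite (compA _ (x *> alpha)) -whisker_exchange -!compA.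
rewrite (compA _ (csa x d q)) -csa_rr -!compA.
rewrite -rwhisker_comp rD !rwhisker_comp.
by rewrite llE !lrE; coh.
Qed.

Lemma pushout_counit (x : comodule Om d) :
  (x ** q *> counit c) \; pushout_coact x ~= idm (x ** q).
Proof.
have aE : (q *> counit c) \; alpha
    = nur _ \; (lun _ \; (counit d <* q)).
  apply: same_eq; apply: same_trans (cm_alpha_counit M) _.
  by rewrite /nur /lun !eqm_compA; exact: same_sym (same_eqml _ _).
have rE : (x *> counit d) \; coact x = nur _.
  apply: same_eq; apply: same_trans (coact_counit x) _.
  exact: same_sym (same_eqm _).
rewrite /pushout_coact !compA -asc_ll -(compA (asc _ _ _)) -lwhisker_comp aE.
rewrite !lwhisker_comp -!compA (compA (x *> (counit d <* q))) -csa_lr -!compA.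
rewrite -rwhisker_comp rE.
rewrite /asc /csa /lun /nur !lwhisker_eqm !rwhisker_eqm !eqm_compA eqm_comp.
exact: same_eqm.
Qed.

Definition pushout_ob (x : Rcom Om d) : Rcom Om c :=
  Comodule (pushout_coassoc x) (pushout_counit x).

Lemma pushout_colinear (x y : Rcom Om d) (s : mor x y) :
  @colinear _ _ _ (pushout_ob x) (pushout_ob y) (proj1_sig s <* q).
Proof.
case: s => s sP; rewrite /colinear /= /pushout_coact -!compA -rwhisker_comp sP.
rewrite rwhisker_comp !compA -asc_rr; congr (_ \; _).
rewrite -!compA; congr (_ \; _); rewrite csa_rr !compA.
by rewrite whisker_exchange.
Qed.

Definition pushout : functor (Rcom Om d) (Rcom Om c).
Proof.
refine (@Functor (Rcom Om d) (Rcom Om c) pushout_ob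
  (fun x y s => exist _ _ (pushout_colinear s)) _ _);
  move=> *; apply: comodule_mor_eq.
- exact: hcomp_id.
- exact: rwhisker_comp.
Defined.

End Pushout.

Section Pullback.
Context {B : two_category} {d c : comonad B} (M : comonad_morphism d c).
Local Notation p := (cm_p M).
Local Notation q := (cm_q M).
Local Notation mu := (cm_mu M).
Local Notation eta := (cm_eta M).
Local Notation alpha := (cm_alpha M).

(* [(mu ** c) o (p ** alpha)] *)
Definition can : mor (p ** d ** q) c :=
  lun c \; (mu <* c) \; asc p q c \; (p *> alpha) \; csa p d q.

(* [(can ** p) o (p ** d ** eta)] *)
Definition beta : mor (p ** d) (c ** p) :=
  (can <* p) \; asc (p ** d) q p \; (p ** d *> eta) \; nur (p ** d).

(* [(beta ** d) o (p ** comult d)] *)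
Definition lambda : mor (p ** d) (c ** p ** d) :=
  (beta <* d) \; asc p d d \; (p *> comult d).

Context (Om : B).

(* [n ** lambda] *)
Definition lambda_at (n : hom Om (c0 c)) : mor (n ** p ** d) (n ** c ** p ** d) :=
  (asc n c p <* d) \; asc n (c ** p) d \; (n *> lambda) \; csa n p d.

Lemma coact_pd_colinear (n : comodule Om c) :
  @colinear _ _ _ (cofree d (n ** p)) (cofree d (n ** c ** p))
    ((coact n <* p) <* d).
Proof. exact: cofree_colinear. Qed.

Lemma lambda_at_colinear (n : hom Om (c0 c)) :
  @colinear _ _ _ (cofree d (n ** p)) (cofree d (n ** c ** p)) (lambda_at n).
Proof.
set th := asc n c p \; (n *> beta) \; csa n p d.
have -> : lambda_at n = (th <* d) \; cofree_coact d (n ** p).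
  rewrite /lambda_at /lambda /cofree_coact /th; move: beta => b.
  by rewrite llE !rwhisker_comp lrE !lwhisker_comp; coh.
have /= thP := cofree_colinear d th; rewrite /colinear /= in thP *.
rewrite compA thP rwhisker_comp -!compA; congr (_ \; _); apply: same_eq.
apply: same_trans (same_sym (cofree_coassoc d _)).
by rewrite {1}/cofree_coact; exact: same_eqml.
Qed.

Lemma lambda_at_nat (m n : hom Om (c0 c)) (s : mor m n) :
  lambda_at n \; ((s <* p) <* d) = (((s <* c) <* p) <* d) \; lambda_at m.
Proof.
rewrite /lambda_at -!compA csa_rr (compA (n *> _)) whisker_exchange -!compA.
rewrite (compA (asc n _ d)) asc_rr -!compA (compA (asc n c p <* d)).
by rewrite -rwhisker_comp asc_rr rwhisker_comp -!compA.
Qed.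

Definition pair_coact (n : Rcom Om c) :
    mor (cofree d (carrier n ** p)) (cofree d (carrier n ** c ** p)) :=
  exist _ _ (coact_pd_colinear n).

Definition pair_lambda (n : Rcom Om c) :
    mor (cofree d (carrier n ** p)) (cofree d (carrier n ** c ** p)) :=
  exist _ _ (lambda_at_colinear (carrier n)).

(* A choice, for each [n], of the equalizer denoted [eq_n]. *)
Definition equalizer_condition : Type :=
  forall n : Rcom Om c, equalizer (pair_coact n) (pair_lambda n).

Variable E : equalizer_condition.

Definition pd_map (m n : Rcom Om c) (s : mor m n) :
    mor (cofree d (carrier m ** p)) (cofree d (carrier n ** p)) :=
  exist _ _ (cofree_colinear d (proj1_sig s <* p)).

Lemma pd_mapP (m n : Rcom Om c) (s : mor m n) :
  pair_coact n \; (pd_map s \; eq_arr (E m))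
  = pair_lambda n \; (pd_map s \; eq_arr (E m)).
Proof.
pose pcd_map : mor (cofree d (carrier m ** c ** p))
    (cofree d (carrier n ** c ** p)) :=
  exist _ _ (cofree_colinear d ((proj1_sig s <* c) <* p)).
have sr : pair_coact n \; pd_map s = pcd_map \; pair_coact m.
  apply: comodule_mor_eq; rewrite /= -!rwhisker_comp.
  by case: {pcd_map} s => s /= ->.
have sl : pair_lambda n \; pd_map s = pcd_map \; pair_lambda m.
  by apply: comodule_mor_eq; apply: lambda_at_nat.
by rewrite !compA sr sl -!compA (proj1 (eq_arrP (E m))).
Qed.

(* [eq_n o P(s) = (s ** p ** d) o eq_m]. *)
Definition pullback_map (m n : Rcom Om c) (s : mor m n) :
    mor (eq_ob (E m)) (eq_ob (E n)) :=
  eq_lift (E n) (pd_mapP s).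

Lemma pullback_id (n : Rcom Om c) : pullback_map (idm n) = idm (eq_ob (E n)).
Proof.
apply: eq_arrK; rewrite eq_liftK comp_idr -[RHS]comp_idl; congr (_ \; _).
by apply: comodule_mor_eq; rewrite /= !hcomp_id.
Qed.

Lemma pullback_comp (m n o : Rcom Om c) (t : mor n o) (s : mor m n) :
  pullback_map (t \; s) = pullback_map t \; pullback_map s.
Proof.
apply: eq_arrK; rewrite compA !eq_liftK -compA eq_liftK compA; congr (_ \; _).
by apply: comodule_mor_eq; rewrite /= !rwhisker_comp.
Qed.

Definition pullback : functor (Rcom Om c) (Rcom Om d) :=
  Functor pullback_id pullback_comp.

End Pullback.

(* Main.v *)
Require Import Defs.
From Corelib Require Import ssreflect.

(** The idea.  For a 1-cell [x], the component of [can] at [x] is a universal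
    arrow from [pushout] to the cofree comodule [cofree c x], obtained from the
    adjunction and from cofreeness of [cofree d (x ** p)].  At a comodule [n]
    the components of [can] form a morphism from the image under [pushout] of
    the pair equalized by [eq_n] to the pair [coact n <* c], [n *> comult c],
    whose equalizer is [coact n].  The induced map on equalizers is the counit
    at [n] of the adjunction between [pushout] and [pullback], and [pullback] is
    fully faithful iff every such counit is invertible.  If [can] is invertible,
    the counit at [n] is invertible iff [pushout] preserves [eq_n].  Conversely,
    if the counits are invertible, then so is every universal arrow, in
    particular each [x *> can]. *)

Set Implicit Arguments.
Unset Strict Implicit.
Unset Printing Implicit Defensive.

Local Open Scope cell_scope.

Lemma unique_preimage_inj {S T : Type} (phi : S -> T) :
  (forall t, exists! s, phi s = t) -> forall s s', phi s = phi s' -> s = s'.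
Proof.
move=> phi_bij s s' ss'; have [u [_ Uu]] := phi_bij (phi s').
by rewrite -(Uu s ss') -(Uu s').
Qed.

(** * Isomorphisms and equalizers in a category *)

Section Categories.
Context {C : category}.

Lemma is_iso_comp {x y z : C} (g : mor y z) (f : mor x y) :
  is_iso g -> is_iso f -> is_iso (g \; f).
Proof.
move=> [g' [g'g gg']] [f' [f'f ff']]; exists (f' \; g'); split.
  by rewrite compA -(compA f') g'g comp_idr.
by rewrite compA -(compA g) ff' comp_idr.
Qed.

Lemma is_iso_eqm {x y : C} (e : x = y) : is_iso (eqm e).
Proof. by exists (eqm (eq_sym e)); rewrite !eqm_comp !eqm_id. Qed.

Lemma is_iso_mono {x y z : C} (f : mor y z) (g h : mor x y) :
  is_iso f -> f \; g = f \; h -> g = h.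
Proof.
move=> [f' [f'f _]] fgh.
by rewrite -(comp_idl g) -(comp_idl h) -f'f -!compA fgh.
Qed.

(** The isomorphisms [b] and [k] identify the two parallel pairs, so [a] is the comparison between
    [i] and an equalizer of the same pair. *)
Lemma equalizer_iff_iso {e x y e' x' y' : C} (i : mor e x) (f g : mor x y)
    (i' : mor e' x') (f' g' : mor x' y') (a : mor e e') (b : mor x x')
    (k : mor y y') :
  is_equalizer i' f' g' -> is_iso b -> is_iso k ->
  k \; f = f' \; b -> k \; g = g' \; b -> b \; i = i' \; a ->
  is_equalizer i f g <-> is_iso a.
Proof.
move=> [fgi' Ui'] bI kI kf kg bi.
have i'K z (s t : mor z e') : i' \; s = i' \; t -> s = t.
  move=> st; have [|u [_ Uu]] := Ui' z (i' \; t); first by rewrite !compA fgi'.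
  by rewrite -(Uu s st) -(Uu t).
split=> [[fgi Ui] | aI].
- have [b' [b'b bb']] := bI.
  (* The inverse of [a] lifts [i'], carried back along the inverse of [b], through [i]. *)
  have [|a' [ia' _]] := Ui _ (b' \; i').
    apply: (is_iso_mono kI); rewrite !compA kf kg -!(compA _ b) bb'.
    by rewrite !comp_idr.
  exists a'; split.
    have [|u [_ Uu]] := Ui _ i; first by [].
    rewrite -(Uu (idm e)) ?comp_idr // -(Uu (a' \; a)) //.
    by rewrite compA ia' -compA -bi compA b'b comp_idl.
  by apply: i'K; rewrite compA -bi -compA ia' compA bb' comp_idl comp_idr.
- have [a' [a'a aa']] := aI; split.
    by apply: (is_iso_mono kI); rewrite !compA kf kg -!compA bi !compA fgi'.
  move=> z h fh; have [|u [i'u Uu]] := Ui' z (b \; h).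
    by rewrite !compA -kf -kg -!compA fh.
  exists (a' \; u); split.
    apply: (is_iso_mono bI).
    by rewrite compA bi -compA (compA a) aa' comp_idl.
  move=> t it; apply: (is_iso_mono aI); rewrite compA aa' comp_idl.
  by apply: Uu; rewrite compA -bi -compA it.
Qed.

Lemma idm_same_eqm {x y : C} (e : x = y) : idm y ~= eqm e.
Proof. by case: _ / e. Qed.

End Categories.

(** * Adjunctions given by universal arrows *)

Section RightAdjoint.
Context {C D : category} (Q : functor D C) (P : functor C D).
Variable e : forall n : C, mor (Q (P n)) n.
Hypothesis e_nat : forall (m n : C) (s : mor m n),
  e n \; fmap Q (fmap P s) = s \; e m.
Hypothesis e_univ : forall (y : D) (n : C) (g : mor (Q y) n),
  exists! f : mor y (P n), e n \; fmap Q f = g.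

Lemma transpose_inj (y : D) (n : C) (f f' : mor y (P n)) :
  e n \; fmap Q f = e n \; fmap Q f' -> f = f'.
Proof. by apply: (unique_preimage_inj (phi := fun f => _ \; fmap Q f)). Qed.

(** Under the bijection [e_univ], the action of [P] on morphisms out of [m] becomes precomposition
    with [e m]. *)
Lemma fully_faithful_iff_counit_iso :
  fully_faithful P <-> forall n, is_iso (e n).
Proof.
split=> [[fP iP] n | eI].
- have epi m (s t : mor n m) : s \; e n = t \; e n -> s = t.
    by rewrite -!e_nat => /transpose_inj; apply: iP.
  (* [u] is the unit at [P n]; its preimage under [P] is a left inverse of [e n]. *)
  have [u [eu _]] := e_univ (idm (Q (P n))).
  have [s Ps] := fP _ _ u.
  have se : s \; e n = idm _ by rewrite -e_nat Ps.
  by exists s; split=> //; apply: epi; rewrite -compA se comp_idl comp_idr.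
- split=> m n.
    move=> g; have [e' [e'e ee']] := eI m.
    exists (e n \; fmap Q g \; e'); apply: transpose_inj.
    by rewrite e_nat -!compA e'e comp_idr.
  move=> f g fg; have [e' [e'e ee']] := eI m.
  rewrite -(comp_idr f) -(comp_idr g) -ee' !compA -!e_nat.
  by rewrite fg.
Qed.

(** Two universal arrows from [Q] to [n] differ by [fmap Q] of an isomorphism. *)
Lemma universal_arrow_iso (y : D) (n : C) (b : mor (Q y) n) :
  (forall (z : D) (g : mor (Q z) n), exists! f : mor z y, b \; fmap Q f = g) ->
  is_iso (e n) -> is_iso b.
Proof.
move=> b_univ eI.
have bK z (f f' : mor z y) : b \; fmap Q f = b \; fmap Q f' -> f = f'.
  by apply: (unique_preimage_inj (phi := fun f => _ \; fmap Q f)).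
have [u [eu _]] := e_univ b; have [v [bv _]] := b_univ _ (e n).
rewrite -eu; apply: is_iso_comp => //; exists (fmap Q v).
split; rewrite -fmap_comp -fmap_id; congr (fmap Q _).
  by apply: bK; rewrite fmap_comp compA bv eu fmap_id comp_idr.
by apply: transpose_inj; rewrite fmap_comp compA eu bv fmap_id comp_idr.
Qed.

End RightAdjoint.

(** * Isomorphisms of 2-cells and of comodules *)

Lemma lwhisker_iso {B : two_category} {X Y Z : B} (f : hom X Y)
    (g g' : hom Y Z) (t : mor g g') :
  is_iso t -> is_iso (f *> t).
Proof.
by case=> u [ut tu]; exists (f *> u); rewrite -!lwhisker_comp ut tu !hcomp_id.
Qed.

Section RcomIso.
Context {B : two_category} {Om : B} {c : comonad B}.

(** The inverse of a colinear 2-cell is colinear. *)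
Lemma Rcom_iso (m n : Rcom Om c) (s : mor m n) :
  is_iso s <-> is_iso (proj1_sig s).
Proof.
split=> [[t [ts st]] | [t [ts st]]].
  by exists (proj1_sig t); split;
    [have := f_equal (@proj1_sig _ _) ts | have := f_equal (@proj1_sig _ _) st].
have tP : @colinear _ _ _ n m t.
  case: s ts st => s sP /= ts st; rewrite /colinear in sP *.
  rewrite -(comp_idl (coact m \; t)) -hcomp_id -ts rwhisker_comp -!compA.
  by rewrite (compA (s <* c)) -sP -compA st comp_idr.
by exists (exist _ t tP); split; apply: comodule_mor_eq.
Qed.

End RcomIso.

(* The components at [x] of the natural transformation given by a structure
   2-cell between the functors [x |-> x ** f].  As [**] associates to the left,
   no coherence 2-cell occurs in the equations between components. *)
Section Components.
Context {B : two_category} {Om : B}.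

(** * Cofree comodules, and the coaction as an equalizer *)

Section Comonad.
Context {c : comonad B}.

Definition counit_at (x : hom Om (c0 c)) : mor (x ** c) x :=
  eqm (comp1_1r x) \; (x *> counit c).

Lemma counit_at_nat (x y : hom Om (c0 c)) (s : mor x y) :
  counit_at y \; (s <* c) = s \; counit_at x.
Proof.
rewrite /counit_at -compA whisker_exchange compA (compA s).
by congr (_ \; _); apply: same_nat; apply: hcomp_1r.
Qed.

Lemma comult_at_nat (x y : hom Om (c0 c)) (s : mor x y) :
  cofree_coact c y \; (s <* c) = ((s <* c) <* c) \; cofree_coact c x.
Proof. exact: cofree_colinear. Qed.

Lemma comodule_coassoc (m : Rcom Om c) :
  (coact m <* c) \; coact m = cofree_coact c (carrier m) \; coact m.
Proof.
apply: same_eq; apply: same_trans (coact_coassoc m) _.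
by rewrite /cofree_coact -compA; apply: same_sym; apply: same_eqml.
Qed.

Lemma comodule_counit (m : Rcom Om c) :
  counit_at (carrier m) \; coact m = idm (carrier m).
Proof.
apply: same_eq; rewrite /counit_at -compA.
exact: same_trans (same_eqml _ _) (coact_counit m).
Qed.

Lemma comult_at_counitl (x : hom Om (c0 c)) :
  (counit_at x <* c) \; cofree_coact c x = idm (x ** c).
Proof.
apply: same_eq; rewrite /counit_at /cofree_coact rwhisker_comp rwhisker_eqm.
rewrite -compA; apply: same_trans (same_eqml _ _) _.
rewrite compA -asc_lr -compA -lwhisker_comp.
apply: same_trans (same_eqml _ _) _.
by rewrite -hcomp_id; apply: lwhisker_same; apply: counitl.
Qed.

Lemma comodule_coact_colinear (m : Rcom Om c) :
  @colinear _ _ _ m (cofree c (carrier m)) (coact m).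
Proof. by rewrite /colinear comodule_coassoc. Qed.

Definition coact_mor (m : Rcom Om c) : mor m (cofree c (carrier m)) :=
  exist _ _ (comodule_coact_colinear m).

Definition cofree_map (x y : hom Om (c0 c)) (s : mor x y) :
    mor (cofree c x) (cofree c y) :=
  exist _ _ (cofree_colinear c s).

Lemma comult_colinear (x : hom Om (c0 c)) :
  @colinear _ _ _ (cofree c x) (cofree c (x ** c)) (cofree_coact c x).
Proof. exact: (comodule_coact_colinear (cofree c x)). Qed.

Definition comult_mor (x : hom Om (c0 c)) :
    mor (cofree c x) (cofree c (x ** c)) :=
  exist _ _ (comult_colinear x).

(** Cofreeness: colinearity followed by the counit law recovers [f] from its composite with
    [counit_at x]. *)
Lemma cofree_morE (y : Rcom Om c) (x : hom Om (c0 c)) (f : mor y (cofree c x)) :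
  proj1_sig f = ((counit_at x \; proj1_sig f) <* c) \; coact y.
Proof.
case: f => f fP /=; rewrite rwhisker_comp -compA.
by rewrite -[X in _ \; X]fP compA comult_at_counitl comp_idl.
Qed.

(* The fork is split by [counit_at] in the category of 1-cells. *)
Lemma coact_equalizer (n : Rcom Om c) :
  is_equalizer (coact_mor n) (cofree_map (coact n)) (comult_mor (carrier n)).
Proof.
split=> [|z h]; first by apply: comodule_mor_eq; apply: comodule_coassoc.
case: h => h hP /(f_equal (@proj1_sig _ _)) /= rh.
pose k := counit_at (carrier n) \; h.
have nk : coact n \; k = h.
  by rewrite /k compA -counit_at_nat -compA rh compA
    -[RHS](comp_idl h) -(comodule_counit (cofree c (carrier n))).
(* The splitting is only a 2-cell, so colinearity of [k] has to be drawn from that of [h]. *)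
have kP : @colinear _ _ _ z n k.
  rewrite /colinear nk /k rwhisker_comp -compA -hP compA.
  by rewrite comult_at_counitl comp_idl.
exists (exist _ k kP); split; first exact: comodule_mor_eq.
move=> [t tP] /(f_equal (@proj1_sig _ _)) /= nt; apply: comodule_mor_eq => /=.
by rewrite /k -nt compA comodule_counit comp_idl.
Qed.

End Comonad.

(** * Components of the adjunction, of [alpha] and of [can] *)

Context {d c : comonad B} (M : comonad_morphism d c).
Local Notation p := (cm_p M).
Local Notation q := (cm_q M).
Local Notation alpha := (cm_alpha M).

Definition mu_at (x : hom Om (c0 c)) : mor (x ** p ** q) x :=
  eqm (comp1_1r x) \; (x *> cm_mu M) \; csa x p q.

Definition eta_at (y : hom Om (c0 d)) : mor y (y ** q ** p) :=
  asc y q p \; (y *> cm_eta M) \; nur y.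

Definition alpha_at (y : hom Om (c0 d)) : mor (y ** d ** q) (y ** q ** c) :=
  asc y q c \; (y *> alpha) \; csa y d q.

Definition can_at (x : hom Om (c0 c)) : mor (x ** p ** d ** q) (x ** c) :=
  (mu_at x <* c) \; alpha_at (x ** p).

Definition beta_at (x : hom Om (c0 c)) : mor (x ** p ** d) (x ** c ** p) :=
  (can_at x <* p) \; eta_at (x ** p ** d).

Lemma mu_at_nat (x y : hom Om (c0 c)) (s : mor x y) :
  mu_at y \; ((s <* p) <* q) = s \; mu_at x.
Proof.
rewrite /mu_at -!compA csa_rr (compA (_ *> _)) whisker_exchange !compA.
by do 2![congr (_ \; _)]; apply: same_nat; apply: hcomp_1r.
Qed.

Lemma eta_at_nat (x y : hom Om (c0 d)) (s : mor x y) :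
  eta_at y \; s = ((s <* q) <* p) \; eta_at x.
Proof.
rewrite /eta_at -!compA; have -> : nur y \; s = (s <* one _) \; nur x.
  by apply: same_nat; apply: same_sym; apply: hcomp_1r.
by rewrite (compA (_ *> _)) whisker_exchange -!compA compA asc_rr -compA.
Qed.

Lemma alpha_at_nat (x y : hom Om (c0 d)) (s : mor x y) :
  alpha_at y \; ((s <* d) <* q) = ((s <* q) <* c) \; alpha_at x.
Proof.
rewrite /alpha_at -!compA csa_rr (compA (_ *> _)) whisker_exchange -!compA.
by rewrite compA asc_rr -compA.
Qed.

Lemma can_at_nat (x y : hom Om (c0 c)) (s : mor x y) :
  can_at y \; (((s <* p) <* d) <* q) = (s <* c) \; can_at x.
Proof.
by rewrite /can_at -compA alpha_at_nat compA -rwhisker_comp mu_at_nat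
  rwhisker_comp -compA.
Qed.

(** The triangle identity whiskered by [y]; what remains are identity 2-cells along equalities of
    1-cells, which agree by proof irrelevance. The next equations between components follow the same
    pattern. *)
Lemma triangle_q_at (y : hom Om (c0 d)) :
  mu_at (y ** q) \; (eta_at y <* q) = idm (y ** q).
Proof.
have T : q *> cm_mu M \; csa _ _ _ \; (cm_eta M <* q) = nur q \; lun q.
  apply: same_eq; apply: same_trans (cm_triangle_q M) _.
  apply: same_trans (idm_same_eqm (comp1_1l q)) _.
  exact: same_sym (same_eqml _ _).
transitivity (eqm (comp1_1r _) \; asc y q _
    \; (y *> (q *> cm_mu M \; csa _ _ _ \; (cm_eta M <* q)))
    \; csa y _ q \; (nur y <* q)).
  by rewrite /mu_at /eta_at !rwhisker_comp !lwhisker_comp llE lrE; coh.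
by rewrite T /asc /csa /lun /nur !(lwhisker_comp, lwhisker_eqm, rwhisker_eqm)
  !eqm_comp eqm_id.
Qed.

Lemma triangle_p_at (x : hom Om (c0 c)) :
  (mu_at x <* p) \; eta_at (x ** p) = idm (x ** p).
Proof.
have T : cm_mu M <* p \; asc _ _ _ \; (p *> cm_eta M)
    = eqm (eq_sym (comp1_1l p)) \; eqm (comp1_1r p).
  apply: same_eq; apply: same_trans (cm_triangle_p M) _.
  apply: same_trans (idm_same_eqm (comp1_1r p)) _.
  exact: same_sym (same_eqml _ _).
transitivity (eqm (f_equal (fun f => f ** p) (comp1_1r x)) \; asc x _ p
    \; (x *> (cm_mu M <* p \; asc _ _ _ \; (p *> cm_eta M)))
    \; csa x p _ \; nur (x ** p)).
  by rewrite /mu_at /eta_at !rwhisker_comp !lwhisker_comp llE lrE; coh.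
by rewrite T /asc /csa /lun /nur !(lwhisker_comp, lwhisker_eqm, rwhisker_eqm)
  !eqm_comp eqm_id.
Qed.

Lemma alpha_at_comult (y : hom Om (c0 d)) :
  cofree_coact c (y ** q) \; alpha_at y
  = (alpha_at y <* c) \; alpha_at (y ** d) \; (cofree_coact d y <* q).
Proof.
have aD : (q *> comult c) \; alpha = csa _ _ _ \; ((alpha <* c) \; asc _ _ _
    \; (d *> alpha) \; csa _ _ _ \; (comult d <* q)).
  apply: same_eq; apply: same_trans (cm_alpha_comult M) _.
  exact: same_sym (same_eqml _ _).
transitivity (asc (y ** q) c c \; asc y q (c ** c)
    \; (y *> (q *> comult c \; alpha)) \; csa y d q).
  rewrite /cofree_coact /alpha_at llE lwhisker_comp -!compA.
  by rewrite (compA (csa _ _ _)) ascK comp_idl.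
rewrite aD /cofree_coact /alpha_at !rwhisker_comp !lwhisker_comp llE !lrE.
by coh.
Qed.

Lemma alpha_at_counit (y : hom Om (c0 d)) :
  counit_at (y ** q) \; alpha_at y = counit_at y <* q.
Proof.
have aE : (q *> counit c) \; alpha = nur q \; (lun q \; (counit d <* q)).
  apply: same_eq; apply: same_trans (cm_alpha_counit M) _.
  by rewrite /nur /lun !eqm_compA; exact: same_sym (same_eqml _ _).
transitivity (eqm (comp1_1r _) \; asc y q _
    \; (y *> (q *> counit c \; alpha)) \; csa y d q).
  rewrite /counit_at /alpha_at llE lwhisker_comp -!compA.
  by rewrite (compA (csa _ _ _)) ascK comp_idl.
by rewrite aE /counit_at !rwhisker_comp !lwhisker_comp lrE; coh.
Qed.

Lemma can_atE (x : hom Om (c0 c)) :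
  can_at x = (x *> can M) \; csa x (p ** d) q \; (csa x p d <* q).
Proof.
rewrite /can_at /mu_at /alpha_at /can !rwhisker_comp !lwhisker_comp llE lrE.
by coh.
Qed.

Lemma lambda_atE (x : hom Om (c0 c)) :
  lambda_at M x = (beta_at x <* d) \; cofree_coact d (x ** p).
Proof.
rewrite /beta_at can_atE /eta_at /lambda_at /lambda /beta /cofree_coact.
(* The equation holds with an arbitrary 2-cell [k] in place of [can M]. *)
move: (can M) => k.
by rewrite !(rwhisker_comp, lwhisker_comp, llE, lrE); coh.
Qed.

(** Naturality of [alpha_at] brings [eta_at] next to [mu_at], where the triangle identity for [q]
    cancels them. Thus [can] determines [alpha]. *)
Lemma can_at_eta (y : hom Om (c0 d)) :
  can_at (y ** q) \; ((eta_at y <* d) <* q) = alpha_at y.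
Proof.
rewrite /can_at -compA alpha_at_nat compA -rwhisker_comp triangle_q_at.
by rewrite hcomp_id comp_idl.
Qed.

(** * The universal arrow from [pushout] to a cofree comodule *)

Lemma can_at_colinear (x : hom Om (c0 c)) :
  @colinear _ _ _ (pushout M Om (cofree d (x ** p))) (cofree c x) (can_at x).
Proof.
change (cofree_coact c x \; can_at x = (can_at x <* c)
  \; (alpha_at (x ** p ** d) \; (cofree_coact d (x ** p) <* q))).
rewrite /can_at (compA (cofree_coact c x)) comult_at_nat.
rewrite -(compA _ (cofree_coact c _)) alpha_at_comult rwhisker_comp.
by rewrite !compA.
Qed.

Definition can_mor (x : hom Om (c0 c)) :
    mor (pushout M Om (cofree d (x ** p))) (cofree c x) :=
  exist _ _ (can_at_colinear x).

Lemma can_mor_iso (x : hom Om (c0 c)) :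
  is_iso (can_mor x) <-> is_iso (x *> can M).
Proof.
set e := csa x (cm_p M ** d) (cm_q M) \; (csa x (cm_p M) d <* cm_q M).
have eI : is_iso e by rewrite /e /csa rwhisker_eqm eqm_comp; apply: is_iso_eqm.
have canE : can_at x = (x *> can M) \; e by rewrite can_atE /e compA.
have [e' [e'e ee']] := eI.
split=> [/Rcom_iso /= canI | canI].
  rewrite -(comp_idr (x *> can M)) -ee' compA -canE.
  by apply: is_iso_comp => //; exists e.
by apply/Rcom_iso; rewrite /= canE; apply: is_iso_comp.
Qed.

Lemma can_mor_coact (n : Rcom Om c) :
  can_mor (carrier n ** c) \; fmap (pushout M Om) (pair_coact M n)
  = cofree_map (coact n) \; can_mor (carrier n).
Proof. by apply: comodule_mor_eq; apply: can_at_nat. Qed.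

(** Naturality moves the [can_at] inside [beta_at] outwards; [can_at_eta] turns the rest into the
    coaction of the pushout, and colinearity of [can_at] concludes. *)
Lemma can_mor_lambda (n : Rcom Om c) :
  can_mor (carrier n ** c) \; fmap (pushout M Om) (pair_lambda M n)
  = comult_mor (carrier n) \; can_mor (carrier n).
Proof.
apply: comodule_mor_eq => /=; rewrite lambda_atE (rwhisker_comp q).
have -> (x : hom Om (c0 c)) : (beta_at x <* d) <* q
    = (((can_at x <* p) <* d) <* q) \; ((eta_at (x ** p ** d) <* d) <* q).
  by rewrite -!rwhisker_comp.
rewrite !(compA (can_at (carrier n ** c))) can_at_nat.
rewrite -(compA _ (can_at (_ ** q))) can_at_eta -compA.
by rewrite [RHS]can_at_colinear.
Qed.

Lemma counit_can_at (x : hom Om (c0 c)) :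
  counit_at x \; can_at x = mu_at x \; (counit_at (x ** p) <* q).
Proof. by rewrite /can_at compA counit_at_nat -compA alpha_at_counit. Qed.

(* The right adjoint of [pushout] exists on cofree comodules without any
   equalizer, and sends [cofree c x] to [cofree d (x ** p)]. *)
Lemma can_mor_universal (x : hom Om (c0 c)) (y : Rcom Om d)
    (g : mor (pushout M Om y) (cofree c x)) :
  exists! f : mor y (cofree d (x ** p)),
    can_mor x \; fmap (pushout M Om) f = g.
Proof.
pose k := counit_at x \; proj1_sig g.
(* The transpose of [k] under the adjunction of [p] and [q], extended to a colinear morphism by
   cofreeness. *)
exists (cofree_map ((k <* p) \; eta_at (carrier y)) \; coact_mor y); split.
  apply: comodule_mor_eq; rewrite (cofree_morE g) -/k /=.
  have -> : ((((k <* p) \; eta_at (carrier y)) <* d) \; coact y) <* q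
      = (((k <* p) <* d) <* q) \; ((eta_at (carrier y) <* d) <* q)
        \; (coact y <* q).
    by rewrite -!rwhisker_comp.
  rewrite !(compA (can_at x)) can_at_nat -(compA _ (can_at (_ ** q))).
  by rewrite can_at_eta -compA.
move=> f fg; apply: comodule_mor_eq; rewrite (cofree_morE f) /=.
congr ((_ <* _) \; _); rewrite /k -fg /=.
rewrite compA counit_can_at -compA -rwhisker_comp rwhisker_comp -compA.
by rewrite -eta_at_nat compA triangle_p_at comp_idl.
Qed.

End Components.

(** * The counit of the adjunction between [pushout] and [pullback] *)

Section PullbackCounit.
Context {B : two_category} {Om : B} {d c : comonad B}.
Context (M : comonad_morphism d c) (E : equalizer_condition M Om).
Local Notation P := (pullback E).
Local Notation Q := (pushout M Om).

Definition coact_eq (n : Rcom Om c) :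
    equalizer (cofree_map (coact n)) (comult_mor (carrier n)) :=
  Equalizer (coact_equalizer n).

Lemma can_mor_eqP (n : Rcom Om c) :
  cofree_map (coact n)
    \; (can_mor M (carrier n) \; fmap Q (eq_arr (E n)))
  = comult_mor (carrier n)
    \; (can_mor M (carrier n) \; fmap Q (eq_arr (E n))).
Proof.
rewrite !compA -can_mor_coact -can_mor_lambda -!compA -!fmap_comp.
by rewrite (proj1 (eq_arrP (E n))).
Qed.

Definition pullback_counit (n : Rcom Om c) : mor (Q (P n)) n :=
  eq_lift (coact_eq n) (can_mor_eqP n).

Lemma coact_pullback_counit (n : Rcom Om c) :
  coact_mor n \; pullback_counit n
  = can_mor M (carrier n) \; fmap Q (eq_arr (E n)).
Proof. exact: (eq_liftK (coact_eq n)). Qed.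

Lemma coact_mor_inj (z n : Rcom Om c) (f g : mor z n) :
  coact_mor n \; f = coact_mor n \; g -> f = g.
Proof. exact: (eq_arrK (E := coact_eq n)). Qed.

Lemma coact_mor_nat (m n : Rcom Om c) (s : mor m n) :
  coact_mor n \; s = cofree_map (proj1_sig s) \; coact_mor m.
Proof. by apply: comodule_mor_eq; case: s. Qed.

Lemma can_mor_nat (x y : hom Om (c0 c)) (s : mor x y) :
  can_mor M y \; fmap Q (cofree_map (s <* cm_p M))
  = cofree_map s \; can_mor M x.
Proof. by apply: comodule_mor_eq; apply: can_at_nat. Qed.

Lemma pullback_counit_nat (m n : Rcom Om c) (s : mor m n) :
  pullback_counit n \; fmap Q (fmap P s) = s \; pullback_counit m.
Proof.
apply: coact_mor_inj.
rewrite !compA coact_pullback_counit coact_mor_nat -!compA.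
rewrite coact_pullback_counit -fmap_comp (eq_liftK (E n)).
by rewrite fmap_comp !compA -can_mor_nat.
Qed.

(** A morphism to [n] amounts to one to [cofree c n] that equalizes the pair of [coact_equalizer].
    Its transpose along [can_mor] equalizes the pair defining [eq_n], hence factors through
    [P n]. *)
Lemma pullback_counit_universal (y : Rcom Om d) (n : Rcom Om c)
    (g : mor (Q y) n) :
  exists! f : mor y (P n), pullback_counit n \; fmap Q f = g.
Proof.
have canK x (f f' : mor y (cofree d (x ** cm_p M))) :
    can_mor M x \; fmap Q f = can_mor M x \; fmap Q f' -> f = f'.
  apply: (unique_preimage_inj (phi := fun f => _ \; fmap Q f)).
  exact: can_mor_universal.
have [h [hg _]] := can_mor_universal (M := M) (coact_mor n \; g).
have hE : pair_coact M n \; h = pair_lambda M n \; h.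
  apply: canK; rewrite !fmap_comp !compA can_mor_coact can_mor_lambda -!compA.
  by rewrite hg !compA (proj1 (coact_equalizer n)).
have counitE f : coact_mor n \; (pullback_counit n \; fmap Q f)
    = can_mor M (carrier n) \; fmap Q (eq_arr (E n) \; f).
  by rewrite compA coact_pullback_counit fmap_comp compA.
exists (eq_lift (E n) hE); split.
  by apply: coact_mor_inj; rewrite counitE eq_liftK.
move=> f fg; apply: eq_arrK; rewrite eq_liftK; apply: canK.
by rewrite hg -fg counitE.
Qed.

Lemma preserves_equalizer_iff_counit_iso (n : Rcom Om c) :
  is_iso (can M) ->
  preserves_equalizer Q (E n) <-> is_iso (pullback_counit n).
Proof.
move=> canI.
have canI_mor (x : hom Om (c0 c)) : is_iso (can_mor M x).
  by apply/can_mor_iso/lwhisker_iso.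
exact: (equalizer_iff_iso (coact_equalizer n) (canI_mor (carrier n))
  (canI_mor (carrier n ** c)) (can_mor_coact M n) (can_mor_lambda M n)
  (eq_sym (coact_pullback_counit n))).
Qed.

End PullbackCounit.

(* [HOm] is automatic when [Om] is [c0 c] (take [x] the identity), and also
   when [can M] is invertible.  It cannot be dropped: for [Om] the empty category in
   Cat, every pullback functor is fully faithful. *)
Theorem theorem3p10 (B : two_category) (d c : comonad B)
    (M : comonad_morphism d c) (Om : B) (E : equalizer_condition M Om)
    (HOm : (forall x : hom Om (c0 c), is_iso (x *> can M)) -> is_iso (can M)) :
  fully_faithful (pullback E) <->
  is_iso (can M) /\
  forall n : Rcom Om c, preserves_equalizer (pushout M Om) (E n).
Proof.
have [ffI Iff] := fully_faithful_iff_counit_iso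
  (@pullback_counit_nat _ _ _ _ M E) (@pullback_counit_universal _ _ _ _ M E).
split=> [/ffI counitI | [canI pres]].
- have canI : is_iso (can M).
    (* [can_mor M x] is compared with the counit at [cofree c x], the other universal arrow to that
       comodule. *)
    apply: HOm => x; apply/can_mor_iso.
    apply: (universal_arrow_iso (@pullback_counit_universal _ _ _ _ M E)) => //.
    exact: can_mor_universal.
  by split=> // n; apply/preserves_equalizer_iff_counit_iso.
- by apply: Iff => n; apply/preserves_equalizer_iff_counit_iso.
Qed.
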